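(* Consider the problem Vertex Triangle $s$-Club with $\ell=1$ (and $s$ a fixed integer), parameterized by $k$. It admits a Turing kernel with $k^4$ vertices if $s=4$ or $s=7$, a Turing kernel with $k^5$ vertices if $s=5$, and a Turing kernel with $k^3$ vertices if $s=6$ or $s\ge 8$.
   Context: Vertex Triangle $s$-Club: given an undirected graph $G=(V,E)$ and integers $k,\ell\ge 1$, decide whether $G$ contains a vertex set $S$ with $|S|\ge k$ such that $G[S]$ has diameter at most $s$ (i.e., $S$ is an $s$-club) and every vertex of $S$ is contained in at least $\ell$ triangles of $G[S]$ (the vertex-$\ell$-triangle property). A Turing kernel with $f(k)$ vertices for this (parameterized) problem is a polynomial-time algorithm that decides every instance while having access to an oracle which, in a single step, answers whether a given instance of the same problem whose graph has at most $f(k)$ vertices (and parameter at most $k$) is a yes-instance. *)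

(* Defs.v *)
From mathcomp Require Import all_boot.
Set Implicit Arguments.
Unset Strict Implicit.
Unset Printing Implicit Defensive.

(** * Graphs and the problem Vertex Triangle s-Club *)

Record sgraph (V : finType) := SGraph {
  adj : rel V;
  adj_sym : symmetric adj;
  adj_irr : irreflexive adj }.

Section Graphs.
Variable V : finType.
Implicit Types (G : sgraph V) (S T : {set V}).

Definition induced G S : sgraph {x : V | x \in S} :=
  @SGraph {x : V | x \in S} (fun x y => adj G (val x) (val y))
    (fun x y => adj_sym G (val x) (val y))
    (fun x => adj_irr G (val x)).

Definition dist_le G (d : nat) (u v : V) : Prop :=
  exists p : seq V, [/\ path (adj G) u p, last u p = v & size p <= d].

(* In particular a nonempty graph of bounded diameter is connected. *)
Definition diam_le G (d : nat) : Prop := forall u v : V, dist_le G d u v.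

Definition triangle G T : bool :=
  (#|T| == 3) && [forall x in T, forall y in T, (x != y) ==> adj G x y].

Definition triangles_at G (v : V) : {set {set V}} :=
  [set T | triangle G T & v \in T].

Definition vertex_triangle G (l : nat) : Prop :=
  forall v : V, l <= #|triangles_at G v|.

End Graphs.

Definition vertex_triangle_club (V : finType) (s l : nat) (G : sgraph V)
    (S : {set V}) : Prop :=
  diam_le (induced G S) s /\ vertex_triangle (induced G S) l.

(** An instance of a parameterized graph problem is a graph on the vertex set
    {0, ..., n-1} together with a parameter [k >= 1]; the bound on [k] is imposed
    where instances are quantified, in [bounded_oracle] and [turing_kernel]. *)
Definition param_problem := forall n : nat, sgraph 'I_n -> nat -> Prop.

Definition VertexTriangleClub (s l : nat) : param_problem :=
  fun n G k => exists2 S : {set 'I_n}, k <= #|S| & vertex_triangle_club s l G S.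

(** * Oracle random access machines

    The programs are while-programs over natural-number registers and arrays,
    whose names are fixed in the program text.  The machine has unit cost; the
    only arithmetic is addition, truncated subtraction and comparison, so that
    numbers gain at most a constant number of bits per step and polynomial time
    agrees with polynomial time on Turing machines.  Queries are written word by
    word on an oracle tape; a query takes one step. *)

Inductive expr :=
  | Const of nat
  | Reg of nat
  | Get of nat & expr               (* Get a e is the cell e of array a *)
  | Add of expr & expr
  | Sub of expr & expr
  | Leq of expr & expr.

Inductive prog :=
  | Skip
  | Assign of nat & expr            (* register := value *)
  | Put of nat & expr & expr        (* Put a i e stores e in cell i of array a *)
  | Seq of prog & prog
  | If of expr & prog & prog
  | While of expr & prog
  | Emit of expr                    (* appends a word to the oracle tape *)
  | Ask of nat.                     (* puts the answer in a register *)

Record state := State {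
  regs : nat -> nat;
  arrays : nat -> nat -> nat;
  tape : seq nat }.

Fixpoint eval (st : state) (e : expr) : nat :=
  match e with
  | Const c => c
  | Reg x => regs st x
  | Get a e1 => arrays st a (eval st e1)
  | Add e1 e2 => eval st e1 + eval st e2
  | Sub e1 e2 => eval st e1 - eval st e2
  | Leq e1 e2 => eval st e1 <= eval st e2
  end.

Definition set_reg (st : state) (x v : nat) : state :=
  State (fun y => if y == x then v else regs st y) (arrays st) (tape st).

Definition set_cell (st : state) (a i v : nat) : state :=
  State (regs st)
    (fun b j => if (b == a) && (j == i) then v else arrays st b j) (tape st).

Definition set_tape (st : state) (w : seq nat) : state :=
  State (regs st) (arrays st) w.

(** [exec O p st t st']: started in [st], the program [p] halts after [t] steps
    in [st'], where [O w b] says that the oracle accepts the query [w] and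
    answers [b].  There is no rule for a query that the oracle does not accept:
    a program that asks one has no terminating execution. *)
Inductive exec (O : seq nat -> bool -> Prop) :
    prog -> state -> nat -> state -> Prop :=
  | ExecSkip st : exec O Skip st 1 st
  | ExecAssign st x e :
      exec O (Assign x e) st 1 (set_reg st x (eval st e))
  | ExecPut st a e1 e2 :
      exec O (Put a e1 e2) st 1 (set_cell st a (eval st e1) (eval st e2))
  | ExecSeq p q st1 st2 st3 t u :
      exec O p st1 t st2 -> exec O q st2 u st3 ->
      exec O (Seq p q) st1 (t + u) st3
  | ExecIfTrue e p q st st' t :
      eval st e != 0 -> exec O p st t st' -> exec O (If e p q) st t.+1 st'
  | ExecIfFalse e p q st st' t :
      eval st e = 0 -> exec O q st t st' -> exec O (If e p q) st t.+1 st'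
  | ExecWhileTrue e p st1 st2 st3 t u :
      eval st1 e != 0 -> exec O p st1 t st2 -> exec O (While e p) st2 u st3 ->
      exec O (While e p) st1 (t + u).+1 st3
  | ExecWhileFalse e p st :
      eval st e = 0 -> exec O (While e p) st 1 st
  | ExecEmit st e :
      exec O (Emit e) st 1 (set_tape st (rcons (tape st) (eval st e)))
  | ExecAsk st x (b : bool) :
      O (tape st) b -> exec O (Ask x) st 1 (set_reg (set_tape st [::]) x b).

(** * Turing kernels *)

(** The order, the parameter, and the adjacency matrix in row-major order. *)
Definition encode (n : nat) (G : sgraph 'I_n) (k : nat) : seq nat :=
  n :: k :: [seq nat_of_bool (adj G i j) | i <- enum 'I_n, j <- enum 'I_n].

(** Number of bits of a sequence of numbers written in binary. *)
Definition bit_size (w : seq nat) : nat := \sum_(x <- w) (trunc_log 2 x).+1.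

(** The input is in array 0; everything else is zero or empty. *)
Definition init_state (w : seq nat) : state :=
  State (fun=> 0) (fun a i => if a == 0 then nth 0 w i else 0) [::].

(** The oracle for the instances of [Q] with at most [m] vertices and parameter
    at most [k]. *)
Definition bounded_oracle (Q : param_problem) (m k : nat)
    (w : seq nat) (b : bool) : Prop :=
  exists (n : nat) (G : sgraph 'I_n) (k' : nat),
    [/\ w = encode G k', n <= m, 1 <= k' <= k & b <-> Q n G k'].

(** A single program decides every instance [(G, k)] in polynomial time, asking
    the oracle for [Q] only about instances with at most [f k] vertices and
    parameter at most [k].  The answer is "yes" if register 0 is nonzero. *)
Definition turing_kernel (Q : param_problem) (f : nat -> nat) : Prop :=
  exists (p : prog) (c d : nat),
    forall (n : nat) (G : sgraph 'I_n) (k : nat), 1 <= k ->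
    exists (t : nat) (st : state),
      [/\ exec (bounded_oracle Q (f k) k) p (init_state (encode G k)) t st,
          t <= c * bit_size (encode G k) ^ d &
          regs st 0 != 0 <-> Q n G k].

(* Main.v *)
Require Import Defs.
From mathcomp Require Import all_boot.
From mathcomp Require Import zify.
From Stdlib Require Import Classical_Prop.
Set Implicit Arguments.
Unset Strict Implicit.
Unset Printing Implicit Defensive.

(** Let i = s/2 - 1, rounded down.  A vertex outside all triangles of G belongs to
    no solution, and deleting it destroys no triangle; so distances are taken in
    the subgraph A of the vertices that lie in triangles.  Add to a ball of radius
    i in A all triangles through its vertices: the result has diameter at most
    2 (i + 1) <= s, so a ball of radius i with at least k vertices shows that the
    answer is yes.  Otherwise a ball of radius c i has at most k^c vertices.  A
    solution lies in the ball of radius s around each of its vertices, so it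
    suffices to query these balls, and s <= c i holds for c = 4, 5, 4 if
    s = 4, 5, 7 and for c = 3 if s = 6 or s >= 8. *)

(** * Clubs and balls *)

Section Clubs.
Variables (V : finType) (G : sgraph V).
Implicit Types (S : {set V}) (u v w : V).

(** Distance in the subgraph induced by [S], phrased in [G] to avoid the subtype. Only the vertices
    after the start are constrained, so walks concatenate directly. *)
Definition linked S d u v : Prop :=
  exists p, [/\ path (adj G) u p, last u p = v, size p <= d & {subset p <= S}].

Definition in_triangle u : bool :=
  [exists w, exists x, [&& adj G u w, adj G w x & adj G u x]].

Lemma in_triangleP u :
  reflect (exists w x, [&& adj G u w, adj G w x & adj G u x]) (in_triangle u).
Proof.
apply: (iffP existsP) => [[w /existsP[x H]]|[w [x H]]]; first by exists w, x.
by exists w; apply/existsP; exists x.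
Qed.

Lemma adj_neq u v : adj G u v -> u != v.
Proof. by apply: contraTneq => ->; rewrite adj_irr. Qed.

Lemma vertex_triangle1P :
  vertex_triangle G 1 <-> forall u, in_triangle u.
Proof.
split=> H u.
  have /card_gt0P[T] := H u; rewrite inE => /andP[/andP[/eqP T3 /forall_inP aT] uT].
  have /cards2P[w [x [wx DT]]] : #|T :\ u| == 2.
    by move: (cardsD1 u T); rewrite T3 uT add1n => -[<-].
  have /setD1P[wu wT] : w \in T :\ u by rewrite DT !inE eqxx.
  have /setD1P[xu xT] : x \in T :\ u by rewrite DT !inE eqxx orbT.
  have aE y z : y \in T -> z \in T -> y != z -> adj G y z.
    by move=> /aT/forall_inP yT /yT/implyP.
  by apply/in_triangleP; exists w, x; rewrite !aE // eq_sym.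
have /in_triangleP[w [x /and3P[uw wx ux]]] := H u.
apply/card_gt0P; exists [set u; w; x]; rewrite !inE eqxx andbT; apply/andP; split.
  rewrite setUC cardsU1 cards2 !inE negb_or (adj_neq uw).
  by rewrite ![x == _]eq_sym (adj_neq ux) (adj_neq wx).
apply/forall_inP => y yT; apply/forall_inP => z zT; apply/implyP.
by move: yT zT; rewrite !inE -!orbA; do 2![case/or3P=> /eqP->];
  rewrite ?eqxx // adj_sym.
Qed.

Lemma linkedS S d d' u v : d <= d' -> linked S d u v -> linked S d' u v.
Proof. by move=> dd [p [? ? sz ?]]; exists p; split=> //; apply: leq_trans dd. Qed.

Lemma linked_trans S d d' u v w :
  linked S d u v -> linked S d' v w -> linked S (d + d') u w.
Proof.
move=> [p [up pv szp pS]] [q [vq qw szq qS]]; exists (p ++ q); split.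
- by rewrite cat_path up pv.
- by rewrite last_cat pv.
- by rewrite size_cat leq_add.
- by move=> x; rewrite mem_cat => /orP[/pS|/qS].
Qed.

(** The reversed walk ends in [u], which [linked] itself does not place in [S]. *)
Lemma linked_sym S d u v : u \in S -> linked S d u v -> linked S d v u.
Proof.
move=> uS [p [up <- szp pS]]; exists (rev (belast u p)); split.
- by rewrite rev_path (eq_path (e' := adj G)) // => x y; rewrite adj_sym.
- by case: p {up szp pS} => //= x p; rewrite rev_cons last_rcons.
- by rewrite size_rev size_belast.
- by move=> x; rewrite mem_rev => /mem_belast; rewrite inE => /predU1P[->|/pS].
Qed.

End Clubs.

Section InducedClubs.
Variables (V : finType) (G : sgraph V) (S : {set V}).

Lemma dist_le_inducedP d (u v : {x | x \in S}) :
  dist_le (induced G S) d u v <-> linked G S d (val u) (val v).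
Proof.
split=> [[p [up <- szp]]|[p [up pv szp pS]]].
  exists (map val p); rewrite last_map size_map; split=> //.
    by rewrite path_map.
  by move=> _ /mapP[y _ ->]; apply: valP.
have [q Dq] : exists q : seq {x | x \in S}, p = map val q.
  elim: p pS {up pv szp} => [|x p IHp] pS; first by exists [::].
  have xS : x \in S by rewrite pS ?mem_head.
  have [|q ->] := IHp; first by move=> y yp; rewrite pS // inE yp orbT.
  by exists (exist _ x xS :: q).
rewrite Dq path_map in up; exists q; split=> //.
  by apply: val_inj; rewrite -last_map -Dq.
by rewrite -(size_map val) -Dq.
Qed.

Lemma clubP s :
  vertex_triangle_club s 1 G S <->
  {in S &, forall u v, linked G S s u v} /\
  {in S, forall u, exists w x,
     [/\ w \in S, x \in S & [&& adj G u w, adj G w x & adj G u x]]}.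
Proof.
rewrite /vertex_triangle_club vertex_triangle1P; split=> -[dS tS]; split.
- by move=> u v uS vS; apply/(dist_le_inducedP s (exist _ u uS) (exist _ v vS)).
- move=> u uS; have /in_triangleP[[w wS] [[x xS] /= ?]] := tS (exist _ u uS).
  by exists w, x.
- by move=> u v; apply/dist_le_inducedP/dS; apply: valP.
- move=> u; have [w [x [wS xS uwx]]] := tS _ (valP u).
  by apply/in_triangleP; exists (exist _ w wS), (exist _ x xS).
Qed.

End InducedClubs.

(** Walks and triangles survive a map that preserves adjacency on [S]; sizes are left to the
    caller. *)
Lemma club_imset (V W : finType) (G : sgraph V) (H : sgraph W) (f : V -> W) s
    (S : {set V}) :
  {in S &, forall x y, adj G x y -> adj H (f x) (f y)} ->
  vertex_triangle_club s 1 G S -> vertex_triangle_club s 1 H (f @: S).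
Proof.
move=> fG /clubP[dS tS]; apply/clubP; split.
  move=> _ _ /imsetP[u uS ->] /imsetP[v vS ->].
  have [p [up <- szp pS]] := dS u v uS vS.
  exists (map f p); rewrite last_map size_map; split=> //.
    elim: p u uS up pS {szp} => //= x p IHp u uS /andP[ux xp] pS.
    have xS : x \in S by rewrite pS ?mem_head.
    by rewrite fG //= IHp // => y yp; rewrite pS // inE yp orbT.
  by move=> _ /mapP[y /pS yS ->]; rewrite imset_f.
move=> _ /imsetP[u uS ->]; have [w [x [wS xS /and3P[uw wx ux]]]] := tS u uS.
by exists (f w), (f x); rewrite !imset_f // !fG.
Qed.

(** Along the enumeration of a set [B] this is a copy of the subgraph induced by [B] on an initial
    segment of the integers, the form that queries must have. *)
Definition pullback (V W : finType) (f : V -> W) (G : sgraph W) : sgraph V :=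
  @SGraph V (fun x y => adj G (f x) (f y))
    (fun x y => adj_sym G (f x) (f y)) (fun x => adj_irr G (f x)).

Definition has_club (V : finType) (G : sgraph V) (s k : nat) (B : {set V}) : Prop :=
  exists S : {set V},
    [/\ S \subset B, k <= #|S| & vertex_triangle_club s 1 G S].

Lemma has_club_enum_val (n : nat) (G : sgraph 'I_n) s k (B : {set 'I_n}) :
  VertexTriangleClub s 1 (pullback (@enum_val _ (mem B)) G) k <->
  has_club G s k B.
Proof.
split=> [[S kS clS]|[S [SB kS clS]]].
  exists (enum_val @: S); split; last by apply: club_imset clS.
  - by apply/subsetP => _ /imsetP[x _ ->]; apply: enum_valP.
  - by rewrite card_imset //; apply: enum_val_inj.
(* [enum_rank_in] needs an element of [B], so an empty solution is treated apart. *)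
have [S0|[v0 v0S]] := set_0Vmem S.
  exists set0; last by apply/clubP; split=> u; rewrite inE.
  by move: kS; rewrite S0 !cards0.
have g_can := enum_rankK_in (subsetP SB _ v0S).
exists (enum_rank_in (subsetP SB _ v0S) @: S).
  rewrite card_in_imset // => x y xS yS.
  by apply: (can_in_inj g_can); apply: (subsetP SB).
apply: club_imset clS => x y xS yS xy /=.
by rewrite !g_can //; apply: (subsetP SB).
Qed.

(** * Covering, size and clubs of balls *)

Section Balls.
Variables (V : finType) (G : sgraph V).
Implicit Types (u v w x : V).

(* Balls of the subgraph of G induced by the vertices that lie in triangles. *)
Fixpoint ball v j : {set V} :=
  if j is j'.+1 then
    [set u | (u \in ball v j') ||
       in_triangle G u && [exists w in ball v j', adj G u w]]
  else [set v].

Lemma ballS v j u :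
  (u \in ball v j.+1) =
  (u \in ball v j) || in_triangle G u && [exists w in ball v j, adj G u w].
Proof. by rewrite inE. Qed.

Lemma ball_center v j : v \in ball v j.
Proof. by elim: j => [|j IHj]; rewrite ?inE ?eqxx // IHj. Qed.

Lemma ball_in_triangle v j :
  in_triangle G v -> {in ball v j, forall u, in_triangle G u}.
Proof.
move=> vT; elim: j => [|j IHj] u; first by rewrite inE => /eqP->.
by rewrite ballS => /orP[/IHj|/andP[]].
Qed.

Lemma subset_ball v j j' : j <= j' -> ball v j \subset ball v j'.
Proof.
move=> /subnK<-; elim: (j' - j) => //= m IHm.
by apply: subset_trans IHm _; apply/subsetP => u uB; rewrite ballS uB.
Qed.

(** A walk is cut after its first [a] steps; balls grow at the far end, so the induction is on
    [b]. *)
Lemma ballD v a b : ball v (a + b) \subset \bigcup_(w in ball v a) ball w b.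
Proof.
elim: b => [|b IHb].
  by rewrite addn0; apply/subsetP => u uB; apply/bigcupP; exists u; rewrite ?inE.
rewrite addnS; apply/subsetP => u; rewrite ballS => /orP[|/andP[uT]].
  move=> /(subsetP IHb)/bigcupP[w wB uB]; apply/bigcupP; exists w => //.
  by rewrite ballS uB.
case/exists_inP=> x /(subsetP IHb)/bigcupP[w wB xB] ux; apply/bigcupP.
exists w => //; rewrite ballS uT; apply/orP; right; apply/exists_inP; by exists x.
Qed.

(** By [ballD] the ball of radius (c + 1) i is covered by the balls of radius i around the vertices
    of the ball of radius c i. These centers lie in triangles, so the bound [k] applies to each. *)
Lemma card_ball_mul i k c v :
  (forall w, in_triangle G w -> #|ball w i| <= k) -> in_triangle G v ->
  #|ball v (c * i)| <= k ^ c.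
Proof.
move=> small vT; elim: c => [|c IHc]; first by rewrite cards1.
rewrite mulSn addnC expnSr; apply: leq_trans (subset_leq_card (ballD _ _ _)) _.
apply: (@leq_trans (\sum_(w in ball v (c * i)) #|ball w i|)).
  elim/big_ind2: _ => [|? x ? y Hx Hy|//]; first by rewrite cards0.
  by apply: leq_trans (leq_card_setU _ _) _; apply: leq_add.
apply: (@leq_trans (\sum_(w in ball v (c * i)) k)).
  by apply: leq_sum => w /(ball_in_triangle vT)/small.
by rewrite sum_nat_const leq_mul2r IHc orbT.
Qed.

(** Every vertex of a walk inside the club lies in a triangle, so the walk survives in the subgraph
    in which balls are taken. *)
Lemma club_sub_ball s (S : {set V}) v :
  vertex_triangle_club s 1 G S -> v \in S -> S \subset ball v s.
Proof.
move=> /clubP[dS tS] vS; apply/subsetP => u /(dS v u vS)[p [vp <- szp pS]].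
apply: subsetP (subset_ball v szp) _ _ => {szp}.
elim/last_ind: p vp pS => [|p x IHp]; first by rewrite !inE.
rewrite rcons_path last_rcons size_rcons => /andP[vp px] pS; rewrite ballS.
have [|w [y [_ _ wy]]] := tS x; first by rewrite pS // mem_rcons mem_head.
have -> : in_triangle G x by apply/in_triangleP; exists w, y.
apply/orP; right; apply/exists_inP; exists (last v p); last by rewrite adj_sym.
by apply: IHp => // z zp; rewrite pS // mem_rcons inE zp orbT.
Qed.

Lemma club_in_triangle s (S : {set V}) u :
  vertex_triangle_club s 1 G S -> u \in S -> in_triangle G u.
Proof.
by case/clubP=> _ tS /tS[w [x [_ _ H]]]; apply/in_triangleP; exists w, x.
Qed.

(* The ball of radius i becomes a club once the triangles through its vertices
   are added: every vertex is then at distance at most i + 1 from the center. *)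
Lemma large_ball_club s i v :
  i.+1.*2 <= s -> in_triangle G v ->
  exists2 S : {set V}, ball v i \subset S & vertex_triangle_club s 1 G S.
Proof.
move=> les vT.
(* [tri u w] says that the edge between [u] and [w] lies in a triangle, so [S] adds the other
   corners of the triangles that meet the ball. *)
pose tri u w := [exists x, [&& adj G u w, adj G w x & adj G u x]].
pose S := ball v i :|: [set w | [exists u in ball v i, tri u w]].
have triS u w : u \in ball v i -> tri u w -> w \in S.
  by move=> uB uw; rewrite !inE; apply/orP; right; apply/exists_inP; exists u.
have BS : ball v i \subset S by apply: subsetUl.
have vS : v \in S by rewrite (subsetP BS) ?ball_center.
have step d u w : w \in S -> adj G u w -> linked G S d v u -> linked G S d.+1 v w.
  move=> wS uw vu; rewrite -addn1; apply: linked_trans vu _.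
  by exists [:: w]; split; rewrite //= ?uw // => x; rewrite inE => /eqP->.
have linkB j : j <= i -> {in ball v j, forall u, linked G S j v u}.
  elim: j => [|j IHj] ji u; first by rewrite inE => /eqP->; exists [::].
  move=> uB; have uS : u \in S by apply: subsetP BS _ (subsetP (subset_ball v ji) _ uB).
  move: uB; rewrite ballS => /orP[/(IHj (ltnW ji))|/andP[_ /exists_inP[w wB uw]]].
    exact: linkedS.
  by apply: (step _ w) => //; [rewrite adj_sym | apply: IHj => //; apply: ltnW].
have linkS u : u \in S -> linked G S i.+1 v u.
  move=> uS; move: (uS); rewrite inE => /orP[/(linkB i (leqnn i))|].
    exact: linkedS.
  rewrite inE => /exists_inP[w wB /existsP[x /and3P[wu _ _]]].
  by apply: (step _ w) => //; apply: linkB.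
exists S => //; apply/clubP; split.
  move=> u w uS wS; apply: linkedS les _; rewrite -addnn.
  by apply: linked_trans (linkS _ wS); apply: linked_sym (linkS _ uS).
move=> u uS; move: (uS); rewrite inE => /orP[uB|].
  have /in_triangleP[w [x uwx]] := ball_in_triangle vT uB.
  have /and3P[uw wx ux] := uwx.
  exists w, x; split=> //; apply: (triS u) => //; apply/existsP.
    by exists x.
  by exists w; rewrite ux uw adj_sym wx.
(* An added vertex keeps the triangle that brought it in: [w] is in the ball, and the third corner
   [x] is added for the same reason. *)
rewrite inE => /exists_inP[w wB wu]; move: (wu) => /existsP[x /and3P[wu' ux wx]].
exists w, x; split; first by apply: subsetP BS _ _.
  by apply: (triS w) => //; apply/existsP; exists u; rewrite wx wu' adj_sym ux.
by rewrite adj_sym wu' wx ux.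
Qed.

End Balls.

(** * Reasoning about oracle programs *)

(** Register 0 is where [turing_kernel] reads the answer. [rV] runs over the centers of balls, [rU],
    [rW] and [rX] are counters of inner loops, and [rC] is an accumulator. *)
Definition rAns := 0.
Definition rN := 1.
Definition rK := 2.
Definition rV := 3.
Definition rU := 4.
Definition rW := 5.
Definition rX := 6.
Definition rC := 7.

Definition For (x : nat) (p : prog) : prog :=
  Seq (Assign x (Const 0))
    (While (Leq (Add (Reg x) (Const 1)) (Reg rN))
       (Seq p (Assign x (Add (Reg x) (Const 1))))).

(* An upper bound on the number of steps, provided that every loop makes at
   most n iterations. *)
Fixpoint cost (n : nat) (p : prog) : nat :=
  match p with
  | Seq p q => cost n p + cost n q
  | If _ p q => (cost n p + cost n q).+1
  | While _ p => (n * (cost n p).+1).+1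
  | _ => 1
  end.

(** Each level of loop nesting raises the degree by one. The base [n.+1] keeps all powers positive,
    so that constants and lower powers are absorbed. *)
Lemma cost_poly p : exists c d, forall n, cost n p <= c * n.+1 ^ d.
Proof.
have seq_poly q q' : (exists c d, forall n, cost n q <= c * n.+1 ^ d) ->
    (exists c d, forall n, cost n q' <= c * n.+1 ^ d) ->
  exists c d, forall n, (cost n q + cost n q').+1 <= c * n.+1 ^ d.
  move=> [c [d Hq]] [c' [d' Hq']]; exists (c + c').+1, (d + d') => n.
  have e := Hq n; have e' := Hq' n.
  have le1 : 0 < n.+1 ^ (d + d') by rewrite expn_gt0.
  have led : n.+1 ^ d <= n.+1 ^ (d + d') by rewrite leq_pexp2l ?leq_addr.
  have led' : n.+1 ^ d' <= n.+1 ^ (d + d') by rewrite leq_pexp2l ?leq_addl.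
  have := leq_mul (leqnn c) led; have := leq_mul (leqnn c') led'.
  by rewrite mulSn mulnDl; lia.
elim: p => [|x e|a e e'|p IHp q IHq|e p IHp q IHq|e p [c [d Hp]]|e|x];
  try by exists 1, 0.
- have [c [d H]] := seq_poly _ _ IHp IHq; exists c, d => n.
  exact: leq_trans (leqnSn _) (H n).
- exact: seq_poly.
- exists c.+2, d.+1 => n /=; rewrite expnS.
  have le1 : 0 < n.+1 ^ d by rewrite expn_gt0.
  have := Hp n; move: (n.+1 ^ d) (cost n p) le1 => y z; nia.
Qed.

(** Write sets are computed from the program text, so that frame conditions of concrete programs are
    settled by evaluation. *)
Fixpoint writes_reg (x : nat) (p : prog) : bool :=
  match p with
  | Assign y _ | Ask y => y == x
  | Seq p q | If _ p q => writes_reg x p || writes_reg x q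
  | While _ p => writes_reg x p
  | _ => false
  end.

Fixpoint writes_array (a : nat) (p : prog) : bool :=
  match p with
  | Put b _ _ => b == a
  | Seq p q | If _ p q => writes_array a p || writes_array a q
  | While _ p => writes_array a p
  | _ => false
  end.

Fixpoint writes_tape (p : prog) : bool :=
  match p with
  | Emit _ | Ask _ => true
  | Seq p q | If _ p q => writes_tape p || writes_tape q
  | While _ p => writes_tape p
  | _ => false
  end.

Record frame (p : prog) (st st' : state) : Prop := Frame {
  frame_reg : forall x, ~~ writes_reg x p -> regs st' x = regs st x;
  frame_array : forall a, ~~ writes_array a p -> arrays st' a =1 arrays st a;
  frame_tape : ~~ writes_tape p -> tape st' = tape st }.

Lemma frame_trans p st1 st2 st3 :
  frame p st1 st2 -> frame p st2 st3 -> frame p st1 st3.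
Proof.
move=> [r1 a1 t1] [r2 a2 t2]; split=> [x xp|a ap i|tp].
- by rewrite r2 ?r1.
- by rewrite a2 ?a1.
- by rewrite t2 ?t1.
Qed.

Lemma frame_sub p q st st' :
  (forall x, writes_reg x p -> writes_reg x q) ->
  (forall a, writes_array a p -> writes_array a q) ->
  (writes_tape p -> writes_tape q) ->
  frame p st st' -> frame q st st'.
Proof.
move=> rpq apq tpq [r a t]; split=> [x|b|].
- by move/(contra (rpq x))/r.
- by move/(contra (apq b))/a.
- by move/(contra tpq)/t.
Qed.

(** * Total-correctness rules with time bounds *)

Section Runs.
Variables (O : seq nat -> bool -> Prop) (n : nat).
Implicit Types (p q : prog) (st : state) (Q : state -> Prop).

Lemma exec_frame p st t st' : exec O p st t st' -> frame p st st'.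
Proof.
elim=> {p st t st'} //=.
- by move=> st x e; split=> //= y /negPf; rewrite eq_sym => ->.
- by move=> st a e1 e2; split=> //= b /negPf ab i /=; rewrite eq_sym ab.
- move=> p q st1 st2 st3 _ _ _ f1 _ f2; apply: frame_trans (_ : frame _ _ st2) _.
    by apply: frame_sub f1 => //= [x|a|] ->.
  by apply: frame_sub f2 => //= [x|a|] ->; rewrite orbT.
- by move=> e p q st st' _ _ _; apply: frame_sub => //= [x|a|] ->.
- by move=> e p q st st' _ _ _; apply: frame_sub => //= [x|a|] ->; rewrite orbT.
- move=> e p st1 st2 st3 _ _ _ _ f1 _; apply: frame_trans.
  exact: frame_sub f1.
- by move=> st x b _; split=> //= y /negPf; rewrite eq_sym => ->.
Qed.

(** One judgement carries termination, running time and result, so each rule below settles all three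
    at once. *)
Definition runs p st Q : Prop :=
  exists t st', [/\ exec O p st t st', t <= cost n p & Q st'].

(** The consequence rule supplies the frame of [p], so a specification need only mention what the
    program changes. *)
Lemma runs_weaken p st Q Q' :
  runs p st Q -> (forall st', frame p st st' -> Q st' -> Q' st') -> runs p st Q'.
Proof.
move=> [t [st' [ex le_t Qst']]] QQ'; exists t, st'; split=> //.
by apply: QQ' => //; apply: exec_frame ex.
Qed.

Lemma runs_skip st Q : Q st -> runs Skip st Q.
Proof. by move=> ?; exists 1, st; split=> //; constructor. Qed.

Lemma runs_assign x e st Q : Q (set_reg st x (eval st e)) -> runs (Assign x e) st Q.
Proof. by move=> ?; do 2!eexists; split; [constructor| |eassumption]. Qed.

Lemma runs_put a e1 e2 st Q :
  Q (set_cell st a (eval st e1) (eval st e2)) -> runs (Put a e1 e2) st Q.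
Proof. by move=> ?; do 2!eexists; split; [constructor| |eassumption]. Qed.

Lemma runs_emit e st Q :
  Q (set_tape st (rcons (tape st) (eval st e))) -> runs (Emit e) st Q.
Proof. by move=> ?; do 2!eexists; split; [constructor| |eassumption]. Qed.

Lemma runs_ask x (b : bool) st Q :
  O (tape st) b -> Q (set_reg (set_tape st [::]) x b) -> runs (Ask x) st Q.
Proof. by move=> ? ?; do 2!eexists; split; [constructor; eassumption| |eassumption]. Qed.

Lemma runs_seq p q st Q :
  runs p st (fun st' => runs q st' Q) -> runs (Seq p q) st Q.
Proof.
move=> [t [st1 [ex1 le_t [u [st2 [ex2 le_u Qst2]]]]]].
by exists (t + u), st2; split=> //=; [apply: ExecSeq ex1 ex2 | apply: leq_add].
Qed.

Lemma runs_if e p q st Q :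
  (if eval st e != 0 then runs p st Q else runs q st Q) -> runs (If e p q) st Q.
Proof.
case: (eqVneq (eval st e) 0) => [e0|en0] [t [st' [ex le_t Qst']]];
  exists t.+1, st'; split=> //=.
- exact: ExecIfFalse.
- exact: leq_trans le_t (leq_addl _ _).
- exact: ExecIfTrue.
- exact: leq_trans le_t (leq_addr _ _).
Qed.

(* Since every loop runs through 'I_n, an invariant can be stated in terms of
   the list of the elements that have been treated so far. *)
Lemma runs_for x p st (I : seq 'I_n -> state -> Prop) Q :
    regs st rN = n -> x != rN -> ~~ writes_reg x p -> ~~ writes_reg rN p ->
    (forall l st1 v, I l st1 -> I l (set_reg st1 x v)) ->
    I [::] st ->
    (forall l (i : 'I_n) st1, size l = i -> frame (For x p) st st1 ->
       regs st1 x = i -> I l st1 -> runs p st1 (I (rcons l i))) ->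
    (forall st1, frame (For x p) st st1 -> I (enum 'I_n) st1 -> Q st1) ->
  runs (For x p) st Q.
Proof.
move=> stN xN xp Np Ix I0 Ip IQ; apply: runs_seq; apply: runs_assign => /=.
set st0 := set_reg st x 0.
have fr0 : frame (For x p) st st0.
  by split=> //= y; rewrite negb_or eq_sym => /andP[/negPf->].
have x0 : regs st0 x = n - n by rewrite subnn /= eqxx.
have {}I0 : I (take (n - n) (enum 'I_n)) st0 by rewrite subnn take0; apply: Ix.
set w := While _ _; rewrite /runs.
(* Induction on the number [m] of iterations left: the counter is [n - m], and the first [n - m]
   elements have been treated. *)
suff main m st1 : m <= n -> frame (For x p) st st1 -> regs st1 x = n - m ->
    I (take (n - m) (enum 'I_n)) st1 ->
    exists t st', [/\ exec O w st1 t st',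
      t <= (m * (cost n (Seq p (Assign x (Add (Reg x) (Const 1))))).+1).+1 & Q st'].
  exact: main (leqnn n) fr0 x0 I0.
elim: m st1 => [|m IHm] st1 le_mn fr xm Im.
  exists 1, st1; split=> //.
    apply: ExecWhileFalse => /=.
    rewrite xm (frame_reg fr) ?stN /= ?subn0 ?addn1 ?ltnn //.
    by rewrite !negb_or Np xN.
  by apply: IQ => //; move: Im; rewrite subn0 take_oversize // size_enum_ord.
have lt_mn : n - m.+1 < n by lia.
have frN st' : frame (For x p) st st' -> regs st' rN = n.
  by move=> fr'; rewrite (frame_reg fr') //= !negb_or Np xN.
have [] := Ip (take (n - m.+1) (enum 'I_n)) (Ordinal lt_mn) st1.
- by rewrite size_takel // size_enum_ord ltnW.
- by [].
- by [].
- by [].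
move=> t [st2 [ex le_t I2]].
pose st3 := set_reg st2 x (regs st2 x + 1).
have ex3 : exec O (Seq p (Assign x (Add (Reg x) (Const 1)))) st1 (t + 1) st3.
  by apply: ExecSeq ex _; apply: ExecAssign.
have fr3 : frame (For x p) st st3.
  apply: frame_trans fr _; apply: frame_sub (exec_frame ex3) => //= y ->.
  by rewrite orbT.
have x3 : regs st3 x = n - m.
  by rewrite /= eqxx (frame_reg (exec_frame ex) xp) xm; lia.
have I3 : I (take (n - m) (enum 'I_n)) st3.
  have -> : n - m = (n - m.+1).+1 by lia.
  apply: Ix; rewrite (take_nth (Ordinal lt_mn)) ?size_enum_ord //.
  by rewrite (_ : nth _ _ _ = Ordinal lt_mn) //; apply: val_inj; rewrite /= nth_enum_ord.
have [u [st4 [ex4 le_u Qst4]]] := IHm _ (ltnW le_mn) fr3 x3 I3.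
exists ((t + 1) + u).+1, st4; split=> //.
  by apply: ExecWhileTrue ex3 ex4; rewrite /= xm frN //; lia.
by rewrite mulSn /=; move: le_u => /=; lia.
Qed.

End Runs.

(** Each of the n^2 + 2 words of the input has at least one bit. A time bound in n + 1 is thus a
    bound in the input size. *)
Lemma leq_bit_size n (G : sgraph 'I_n) k : n.+1 <= bit_size (encode G k).
Proof.
rewrite /bit_size; apply: (@leq_trans (\sum_(x <- encode G k) 1)); last first.
  exact: leq_sum.
rewrite sum1_size /= size_allpairs size_enum_ord.
by case: n {G} => // n; rewrite ltnS; nia.
Qed.

(** * The kernelization program *)

Definition Mark (e : expr) : prog := If e (Assign rC (Const 1)) Skip.

Definition Tabulate (x a : nat) (p : prog) (e : expr) : prog :=
  For x (Seq p (Put a (Reg x) e)).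

Definition Adj (x y : nat) : expr := Get 0 (Add (Get 1 (Reg x)) (Reg y)).

(* Array 1 receives the offsets of the rows of the adjacency matrix, since the
   machine cannot multiply. *)
Definition Init : prog :=
  Seq (Assign rN (Get 0 (Const 0)))
  (Seq (Assign rK (Get 0 (Const 1)))
  (Seq (Assign rC (Const 2))
  (For rU
    (Seq (Put 1 (Reg rU) (Reg rC)) (Assign rC (Add (Reg rC) (Reg rN))))))).

(** Array 2 marks the vertices in triangles. A conjunction of bits is tested by comparing their sum
    with their number. *)
Definition Triangles : prog :=
  Tabulate rU 2
    (Seq (Assign rC (Const 0))
      (For rW (For rX
        (Mark (Leq (Const 3) (Add (Adj rU rW) (Add (Adj rW rX) (Adj rU rX))))))))
    (Reg rC).

(* Array j + 3 holds the characteristic function of the ball of radius j. *)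
Definition Grow (j : nat) : prog :=
  Tabulate rU j.+4
    (Seq (Assign rC (Get j.+3 (Reg rU)))
      (If (Get 2 (Reg rU))
        (For rW (Mark (Leq (Const 2) (Add (Get j.+3 (Reg rW)) (Adj rU rW)))))
        Skip))
    (Reg rC).

(** For radius 0, the sum of the two comparisons minus 1 is the truth value of u = v. *)
Fixpoint Balls (s : nat) : prog :=
  if s is s'.+1 then Seq (Balls s') (Grow s')
  else Tabulate rU 3 Skip
         (Defs.Sub (Add (Leq (Reg rU) (Reg rV)) (Leq (Reg rV) (Reg rU))) (Const 1)).

Definition Count (j : nat) : prog :=
  Seq (Assign rC (Const 0))
    (For rU (Assign rC (Add (Reg rC) (Get j.+3 (Reg rU))))).

Definition ForBalls (s : nat) (p : prog) : prog :=
  For rV (If (Get 2 (Reg rV)) (Seq (Balls s) p) Skip).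

Definition TestSize (i : nat) : prog :=
  Seq (Count i) (If (Leq (Reg rK) (Reg rC)) (Assign rAns (Const 1)) Skip).

Definition EmitMatrix (s : nat) : prog :=
  For rU (If (Get s.+3 (Reg rU))
    (For rW (If (Get s.+3 (Reg rW)) (Emit (Adj rU rW)) Skip)) Skip).

(** The guard keeps an earlier yes from being overwritten, and avoids queries whose size is not
    under control. *)
Definition Query (s : nat) : prog :=
  If (Reg rAns) Skip
    (Seq (Count s)
    (Seq (Emit (Reg rC))
    (Seq (Emit (Reg rK))
    (Seq (EmitMatrix s) (Ask rAns))))).

(** Two passes: the balls of radius i around all centers must be known to be small before the first
    query is legal. *)
Definition Kernel (s i : nat) : prog :=
  Seq Init (Seq Triangles
    (Seq (ForBalls s (TestSize i)) (ForBalls s (Query s)))).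

Lemma nth_allpairs (S T R : Type) (f : S -> T -> R) r0 s0 t0 (s : seq S) (t : seq T) i j :
  i < size s -> j < size t ->
  nth r0 [seq f x y | x <- s, y <- t] (i * size t + j) = f (nth s0 s i) (nth t0 t j).
Proof.
elim: s i => //= x s IHs [|i] i_s j_t.
  by rewrite nth_cat size_map mul0n add0n j_t (nth_map t0).
rewrite nth_cat size_map mulSn -addnA ltnNge leq_addr /= addKn.
exact: IHs.
Qed.

(** * Correctness of the subroutines *)

Section Correctness.
Variables (O : seq nat -> bool -> Prop) (n : nat) (G : sgraph 'I_n) (k : nat).
Implicit Types (p : prog) (st : state) (Q : state -> Prop) (i u v w x : 'I_n).

Local Notation runs := (@runs O n).
Local Notation tri := (in_triangle G).

Lemma nth_encode u w : nth 0 (encode G k) (2 + u * n + w) = adj G u w.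
Proof.
have := @nth_allpairs _ _ _ (fun x y => nat_of_bool (adj G x y)) 0 u w
  (enum 'I_n) (enum 'I_n) u w.
by rewrite size_enum_ord !ltn_ord !nth_ord_enum => <-.
Qed.

Lemma runs_mark e st (b c : bool) Q :
  regs st rC = b -> eval st e = c ->
  (forall st', regs st' rC = b || c -> Q st') -> runs (Mark e) st Q.
Proof.
move=> rCb ec HQ; apply: runs_if; rewrite ec; case: c {ec} HQ => /= HQ.
  by apply: runs_assign; apply: HQ; rewrite /= orbT.
by apply: runs_skip; apply: HQ; rewrite orbF.
Qed.

(** The initial bit [b] is arbitrary because nested searches share [rC], and because [Grow] starts
    from membership in the smaller ball. *)
Lemma runs_exists (x : nat) p st (b : bool) (P : pred 'I_n) Q :
    regs st rN = n -> x != rN -> ~~ writes_reg x p -> ~~ writes_reg rN p ->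
    x != rC -> regs st rC = b ->
    (forall i st1 (c : bool), frame (For x p) st st1 -> regs st1 x = i ->
       regs st1 rC = c -> runs p st1 (fun st2 => regs st2 rC = c || P i)) ->
    (forall st1, frame (For x p) st st1 -> regs st1 rC = b || [exists i, P i] ->
       Q st1) ->
  runs (For x p) st Q.
Proof.
move=> stN xN xp Np xC stC Hp HQ.
apply: (runs_for (I := fun l st1 => regs st1 rC = b || has P l)) => //.
- by move=> l st1 v /=; rewrite eq_sym (negPf xC).
- by rewrite orbF.
- move=> l i st1 _ fr st1x st1C; apply: runs_weaken (Hp i st1 _ fr st1x st1C) _.
  by move=> st2 _ ->; rewrite has_rcons -orbA [P i || _]orbC.
move=> st1 fr H; apply: HQ => //; rewrite H; congr (nat_of_bool (_ || _)).
by apply/hasP/existsP => -[i]; [exists i | exists i; rewrite ?mem_enum].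
Qed.

Lemma runs_tabulate (x a : nat) p e st (F : 'I_n -> nat) Q :
    regs st rN = n -> x != rN -> ~~ writes_reg x p -> ~~ writes_reg rN p ->
    ~~ writes_array a p ->
    (forall i st1, frame (Tabulate x a p e) st st1 -> regs st1 x = i ->
       runs p st1 (fun st2 => eval st2 e = F i)) ->
    (forall st1, frame (Tabulate x a p e) st st1 ->
       (forall i, arrays st1 a i = F i) -> Q st1) ->
  runs (Tabulate x a p e) st Q.
Proof.
move=> stN xN xp Np ap Hp HQ.
apply: (runs_for (I := fun l st1 => {in l, forall i, arrays st1 a i = F i}))
  => //=; rewrite ?orbF //.
  move=> l i st1 _ fr st1x Il; apply: runs_seq.
  apply: runs_weaken (Hp i st1 fr st1x) _ => st2 fr2 e2; apply: runs_put => j /=.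
  rewrite mem_rcons inE e2 eqxx /= (frame_reg fr2 xp) st1x.
  case: eqVneq => [->|ji jl]; first by rewrite eqxx.
  by rewrite (negPf (_ : nat_of_ord j != i)) ?(frame_array fr2) ?Il.
by move=> st1 fr IF; apply: HQ => // i; apply: IF; rewrite mem_enum.
Qed.

(** What [Init] establishes; [tri_context] and [ball_context] add the results of [Triangles] and
    [Balls]. *)
Record context st : Prop := Context {
  context_n : regs st rN = n;
  context_k : regs st rK = k;
  context_input : arrays st 0 =1 nth 0 (encode G k);
  context_row : forall u, arrays st 1 u = 2 + u * n }.

Lemma context_frame p st st' :
  frame p st st' ->
  ~~ [|| writes_reg rN p, writes_reg rK p, writes_array 0 p | writes_array 1 p] ->
  context st -> context st'.
Proof.
case=> fr fa _; rewrite !negb_or => /and4P[pN pK p0 p1] [sN sK s0 s1].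
by split=> [||i|u]; rewrite ?fr ?fa.
Qed.

Lemma context_set_rC st c : context st -> context (set_reg st rC c).
Proof. by case. Qed.

Lemma eval_adj st (x y : nat) u w :
  context st -> regs st x = u -> regs st y = w -> eval st (Adj x y) = adj G u w.
Proof. by case=> _ _ s0 s1 /= -> ->; rewrite s1 s0 nth_encode. Qed.

Lemma runs_init : runs Init (init_state (encode G k)) context.
Proof.
do 3![apply: runs_seq; apply: runs_assign] => /=.
(* [rC] holds the offset of the next row; the 2 skips the order and the parameter. *)
pose I (l : seq 'I_n) st :=
  regs st rC = 2 + size l * n /\ {in l, forall u, arrays st 1 u = 2 + u * n}.
apply: (runs_for (I := I)) => //.
- move=> l u st1 lu fr st1U [st1C Il].
  apply: runs_seq; apply: runs_put; apply: runs_assign; split=> /=.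
    by rewrite st1C (frame_reg fr) // size_rcons mulSn /=; lia.
  move=> w; rewrite mem_rcons inE st1U st1C lu.
  case: eqVneq => [->|wu wl]; first by rewrite eqxx.
  by rewrite (negPf (_ : nat_of_ord w != u)) ?Il.
- move=> st1 fr [_ Il]; split; rewrite ?(frame_reg fr) //; first exact: (frame_array fr).
  by move=> u; apply: Il; rewrite mem_enum.
Qed.

Definition tri_context st : Prop :=
  context st /\ forall u, arrays st 2 u = tri u.

Lemma tri_context_frame p st st' :
  frame p st st' ->
  ~~ [|| writes_reg rN p, writes_reg rK p, writes_array 0 p, writes_array 1 p
       | writes_array 2 p] ->
  tri_context st -> tri_context st'.
Proof.
move=> fr; rewrite !orbA negb_or -!orbA => /andP[p' p2] [cst tst]; split.
  exact: context_frame fr p' cst.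
by move=> u; rewrite (frame_array fr).
Qed.

Lemma runs_triangles st : context st -> runs Triangles st tri_context.
Proof.
move=> cst; apply: (runs_tabulate (F := fun u => tri u)) => //.
- exact: context_n cst.
- move=> u st1 fr1 st1U; have c1 := context_frame fr1 isT cst.
  apply: runs_seq; apply: runs_assign.
  apply: (runs_exists (b := false)
    (P := fun w => [exists x, [&& adj G u w, adj G w x & adj G u x]])) => //.
  + exact: context_n c1.
  move=> w st2 b fr2 st2W st2C.
  have c2 := context_frame fr2 isT (context_set_rC _ c1).
  apply: (runs_exists (P := fun x => [&& adj G u w, adj G w x & adj G u x])
    (b := b)) => //.
  + exact: context_n c2.
  move=> x st3 c fr3 st3X st3C; have c3 := context_frame fr3 isT c2.
  apply: (runs_mark (b := c) (c := [&& adj G u w, adj G w x & adj G u x])) => //.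
  have st3W : regs st3 rW = w by rewrite (frame_reg fr3).
  have st3U : regs st3 rU = u by rewrite (frame_reg fr3) // (frame_reg fr2).
  move: (eval_adj c3 st3U st3W) (eval_adj c3 st3W st3X) (eval_adj c3 st3U st3X).
  by rewrite /= => -> -> ->; do 3!case: adj.
- by move=> st1 fr1 H; split=> //; apply: context_frame fr1 isT cst.
Qed.

Definition ball_context v s st : Prop :=
  tri_context st /\
  forall j u, j <= s -> arrays st j.+3 u = (u \in ball G v j).

(** The text of [Balls s] depends on [s], so its write sets need an induction instead of
    evaluation. *)
Lemma balls_safe s :
  [/\ forall x : nat, x < rU -> ~~ writes_reg x (Balls s),
      forall a, a < 3 -> ~~ writes_array a (Balls s) &
      ~~ writes_tape (Balls s)].
Proof.
elim: s => [|s [IHr IHa IHt]].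
  split=> //.
  - by case=> [|[|[|[|x]]]].
  - by case=> [|[|[|a]]].
split=> [x xU|a a3|] /=; last by rewrite (negPf IHt).
- by rewrite (negPf (IHr x xU)); case: x xU => [|[|[|[|x]]]].
- by rewrite (negPf (IHa a a3)); case: a a3 => [|[|[|a]]].
Qed.

Lemma runs_balls s st v :
  tri_context st -> regs st rV = v -> runs (Balls s) st (ball_context v s).
Proof.
move=> cst stV; elim: s => [|s IHs].
  apply: (runs_tabulate (F := fun u => u == v)) => //.
  - exact: context_n cst.1.
  - move=> u st1 fr1 st1U; apply: runs_skip => /=.
    by rewrite st1U (frame_reg fr1) // stV -val_eqE eqn_leq; do 2!case: leq.
  - move=> st1 fr1 H; split; first exact: tri_context_frame fr1 isT cst.
    by move=> [|//] u _; rewrite H inE.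
apply: runs_seq; apply: runs_weaken IHs _ => st1 fr1 [c1 B1].
apply: (runs_tabulate (F := fun u => u \in ball G v s.+1)) => //.
- exact: context_n c1.1.
- move=> u st2 fr2 st2U.
  have c2 : tri_context st2 by apply: tri_context_frame fr2 isT c1.
  (* The new ball goes to a fresh array, so the old one stays intact while it is being read. *)
  have B2 w : arrays st2 s.+3 w = (w \in ball G v s).
    by rewrite (frame_array fr2) ?B1 //= orbF gtn_eqF.
  apply: runs_seq; apply: runs_assign; apply: runs_if => /=.
  rewrite st2U B2 c2.2 ballS.
  case: (boolP (tri u)) => uT /=; last by apply: runs_skip; rewrite orbF.
  apply: (runs_exists (b := u \in ball G v s)
    (P := fun w => (w \in ball G v s) && adj G u w)) => //.
  + exact: context_n c2.1.
  move=> w st3 b fr3 st3W st3C.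
  have c3 := context_frame fr3 isT (context_set_rC _ c2.1).
  have st3U : regs st3 rU = u by rewrite (frame_reg fr3).
  apply: (runs_mark (b := b) (c := (w \in ball G v s) && adj G u w)) => //.
  have := eval_adj c3 st3U st3W; rewrite /= => ->.
  rewrite st3W (frame_array fr3) //= B2.
  by case: (w \in _); case: adj.
- move=> st2 fr2 H; split; first by apply: tri_context_frame fr2 isT c1.
  move=> j u; rewrite leq_eqVlt => /predU1P[->|js]; first exact: H.
  by rewrite (frame_array fr2) ?B1 //= orbF !eqSS gtn_eqF.
Qed.

Lemma runs_count j st v s Q :
  j <= s -> ball_context v s st ->
  (forall st1, frame (Count j) st st1 -> regs st1 rC = #|ball G v j| -> Q st1) ->
  runs (Count j) st Q.
Proof.
move=> js [cst Bst] HQ.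
suff : runs (Count j) st (fun st1 => regs st1 rC = #|ball G v j|).
  by move/runs_weaken; apply.
apply: runs_seq; apply: runs_assign.
apply: (runs_for (I := fun l st1 => regs st1 rC = count [in ball G v j] l)) => //.
- exact: context_n cst.1.
- move=> l u st1 _ fr1 st1U st1C; apply: runs_assign => /=.
  by rewrite -cats1 count_cat /= addn0 st1C st1U (frame_array fr1) //= Bst.
- by move=> st1 _ ->; rewrite cardE -size_filter enumT.
Qed.

(** [B] is what the answer register records on entry: [False] in the first pass, the existence of a
    large ball in the second. Inside the body a zero answer therefore refutes [B]. The tape is empty
    between rounds, so queries do not mix. *)
Lemma runs_for_balls s p st (B : Prop) (P : 'I_n -> Prop) Q :
    ~~ [|| writes_reg rN p, writes_reg rK p, writes_reg rV p, writes_array 0 p,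
           writes_array 1 p | writes_array 2 p] ->
    tri_context st -> (regs st rAns != 0 <-> B) -> tape st = [::] ->
    (forall v st1, tri v -> ball_context v s st1 -> tape st1 = [::] ->
       (B -> regs st1 rAns != 0) ->
       runs p st1 (fun st2 => tape st2 = [::] /\
         (regs st2 rAns != 0 <-> regs st1 rAns != 0 \/ P v))) ->
    (forall st1, tri_context st1 -> tape st1 = [::] ->
       (regs st1 rAns != 0 <-> B \/ exists2 v, tri v & P v) -> Q st1) ->
  runs (ForBalls s p) st Q.
Proof.
move=> p_safe cst stB st_t Hp HQ.
have /norP[pN /norP[pK /norP[pV /norP[p0 /norP[p1 p2]]]]] := p_safe.
have [Br Ba Bt] := balls_safe s.
have safe : ~~ [|| writes_reg rN (ForBalls s p), writes_reg rK (ForBalls s p),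
      writes_array 0 (ForBalls s p), writes_array 1 (ForBalls s p)
    | writes_array 2 (ForBalls s p)].
  by rewrite /= !negb_or !Br // !Ba // pN pK p0 p1 p2.
apply: (runs_for (I := fun l st1 => tape st1 = [::] /\
  (regs st1 rAns != 0 <-> B \/ exists2 v, v \in l & tri v /\ P v))) => //=.
- exact: context_n cst.1.
- by rewrite !negb_or Br ?pV.
- by rewrite !negb_or Br ?pN.
- by split=> //; rewrite stB; split=> [?|[|[]]] //; left.
- move=> l v st1 _ fr1 st1V [st1t st1B]; apply: runs_if => /=.
  have c1 := tri_context_frame fr1 safe cst.
  rewrite st1V c1.2; case: (boolP (tri v)) => vT /=; last first.
    apply: runs_skip; split=> //; rewrite st1B; split=> -[|[u ul uP]]; try by left.
      by right; exists u; rewrite ?mem_rcons ?inE ?ul ?orbT.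
    move: ul; rewrite mem_rcons inE => /predU1P[uv|ul]; last by right; exists u.
    by move: uP vT; rewrite uv => -[->].
  apply: runs_seq; apply: runs_weaken (runs_balls s c1 st1V) _ => st2 fr2 c2.
  have st2A : regs st2 rAns = regs st1 rAns by rewrite (frame_reg fr2) ?Br.
  have B2 : B -> regs st2 rAns != 0 by rewrite st2A st1B; left.
  have st2t : tape st2 = [::] by rewrite (frame_tape fr2).
  apply: runs_weaken (Hp v st2 vT c2 st2t B2) _ => st3 _ [st3t st3A].
  split=> //; rewrite st3A st2A st1B; split.
    move=> [[HB|[u ul uP]]|vP]; first by left.
      by right; exists u; rewrite ?mem_rcons ?inE ?ul ?orbT.
    by right; exists v; rewrite ?mem_rcons ?mem_head.
  move=> [HB|[u]]; first by left; left.
  rewrite mem_rcons inE => /predU1P[->|ul] [uT uP]; first by right.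
  by left; right; exists u.
- move=> st1 fr1 [st1t st1B]; apply: HQ => //.
    exact: tri_context_frame fr1 safe cst.
  rewrite st1B; split=> -[|[v]]; try by left.
    by move=> _ [vT vP]; right; exists v.
  by move=> vT vP; right; exists v; rewrite ?mem_enum.
Qed.

Lemma runs_test_size (i : nat) s v st :
  i <= s -> ball_context v s st -> tape st = [::] ->
  runs (TestSize i) st (fun st1 => tape st1 = [::] /\
    (regs st1 rAns != 0 <-> regs st rAns != 0 \/ k <= #|ball G v i|)).
Proof.
move=> le_is cst st_t; apply: runs_seq.
apply: (runs_count le_is cst) => st1 fr1 st1C; apply: runs_if => /=.
rewrite st1C (frame_reg fr1) // (context_k cst.1.1).
case: (leqP k) => kB /=.
  by apply: runs_assign; split; [rewrite /= (frame_tape fr1) | split=> //; right].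
apply: runs_skip; rewrite (frame_tape fr1) // (frame_reg fr1) //.
by split=> //; split=> [?|[]] //; left.
Qed.

Lemma runs_emit_matrix s v st Q :
  ball_context v s st ->
  (forall st1, frame (EmitMatrix s) st st1 ->
     tape st1 = tape st ++ [seq nat_of_bool (adj G u w) |
       u <- enum (ball G v s), w <- enum (ball G v s)] -> Q st1) ->
  runs (EmitMatrix s) st Q.
Proof.
move=> [[cst tst] Bst] HQ; set B := ball G v s.
have enumB : enum B = [seq u <- enum 'I_n | u \in B] by rewrite enumT.
apply: (runs_for (I := fun l st1 => tape st1 = tape st ++
  [seq nat_of_bool (adj G u w) | u <- [seq u <- l | u \in B], w <- enum B])) => //.
- exact: context_n cst.
- by rewrite cats0.
- move=> l u st1 _ fr1 st1U st1t; apply: runs_if => /=.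
  have c1 := context_frame fr1 isT cst.
  have B1 w : arrays st1 s.+3 w = (w \in B) by rewrite (frame_array fr1) ?Bst.
  rewrite st1U B1 filter_rcons; case: (u \in B) => /=; last exact: runs_skip.
  apply: (runs_for (I := fun l' st2 => tape st2 = tape st1 ++
    [seq nat_of_bool (adj G u w) | w <- [seq w <- l' | w \in B]])) => //.
  + exact: context_n c1.
  + by rewrite cats0.
  + move=> l' w st2 _ fr2 st2W st2t; apply: runs_if => /=.
    have c2 := context_frame fr2 isT c1.
    have st2U : regs st2 rU = u by rewrite (frame_reg fr2).
    rewrite st2W (frame_array fr2) // B1 filter_rcons.
    case: (w \in B) => /=; last exact: runs_skip.
    by apply: runs_emit; rewrite (eval_adj c2 st2U st2W) /= st2t map_rcons rcons_cat.
  + move=> st2 _ ->.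
    by rewrite st1t allpairs_rcons catA enumB.
- by move=> st1 fr1; rewrite -enumB; apply: HQ.
Qed.

End Correctness.

(** * Queries and assembly of the kernel *)

Lemma map_enum_val (T : finType) (A : {pred T}) :
  [seq enum_val i | i <- enum 'I_#|A|] = enum A.
Proof.
case: (pickP A) => [x0 _|/eq_card0 A0].
  rewrite (eq_map (enum_val_nth x0)) (map_comp (nth x0 (enum A)) val) val_enum_ord.
  by rewrite cardE map_nth_iota0 // take_size.
have /size0nil-> : size (enum A) = 0 by rewrite -cardE.
by apply: size0nil; rewrite size_map size_enum_ord.
Qed.

(** [enum_val] follows the order of [enum B], in which [EmitMatrix] meets the vertices, so the tape
    is literally an encoded instance. *)
Lemma encode_pullback n (G : sgraph 'I_n) k (B : {set 'I_n}) :
  encode (pullback (@enum_val _ (mem B)) G) k =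
  [:: #|B|, k & [seq nat_of_bool (adj G u w) | u <- enum B, w <- enum B]].
Proof. by rewrite /encode -map_enum_val allpairs_mapl allpairs_mapr. Qed.

Lemma runs_query s m n (G : sgraph 'I_n) k v st :
  0 < k -> ball_context G k v s st -> tape st = [::] ->
  (regs st rAns = 0 -> #|ball G v s| <= m) ->
  runs (bounded_oracle (VertexTriangleClub s 1) m k) n (Query s) st
    (fun st1 => tape st1 = [::] /\
       (regs st1 rAns != 0 <-> regs st rAns != 0 \/ has_club G s k (ball G v s))).
Proof.
move=> k_gt0 cst st_t small; apply: runs_if => /=.
case: (eqVneq (regs st rAns) 0) => [stA|stA] /=.
2: by apply: runs_skip; split=> //; split=> // _; left.
set B := ball G v s; pose H := pullback (@enum_val _ (mem B)) G.
apply: runs_seq; apply: (runs_count _ (leqnn s) cst) => st1 fr1 st1C.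
apply: runs_seq; apply: runs_emit; apply: runs_seq; apply: runs_emit => /=.
rewrite (frame_tape fr1) // st_t st1C (frame_reg fr1) //= (context_k cst.1.1).
set st2 := set_tape _ _.
have c2 : ball_context G k v s st2.
  have [c1 t1] := tri_context_frame fr1 isT cst.1; split.
    by split; [case: c1|].
  by move=> j u js; rewrite (frame_array fr1) // cst.2.
apply: runs_seq; apply: (runs_emit_matrix _ c2) => st3 fr3 st3t.
(* The problem is a proposition; excluded middle turns it into the bit that the oracle returns. *)
have [b Hb] : exists b : bool, b <-> VertexTriangleClub s 1 H k.
  by case: (classic (VertexTriangleClub s 1 H k)) => ?; [exists true | exists false].
apply: (@runs_ask _ _ _ b); last first.
  by split=> //=; rewrite -has_club_enum_val -/H -Hb; case: (b); split=> [?|[]] //; right.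
exists #|B|, H, k; split=> //; rewrite ?small ?k_gt0 ?leqnn //.
by rewrite st3t encode_pullback.
Qed.

Lemma turing_kernel_balls s i c :
  i.+1.*2 <= s -> s <= c * i ->
  turing_kernel (VertexTriangleClub s 1) (fun k => k ^ c).
Proof.
move=> le_is le_sci.
have le_i_s : i <= s by rewrite -addnn in le_is; lia.
have [a [d Hcost]] := cost_poly (Kernel s i).
exists (Kernel s i), a, d => n G k k_gt0.
pose Large := exists2 v, in_triangle G v & k <= #|ball G v i|.
suff [t [st [ex le_t Hst]]] :
    runs (bounded_oracle (VertexTriangleClub s 1) (k ^ c) k) n (Kernel s i)
      (init_state (encode G k))
      (fun st => regs st rAns != 0 <-> VertexTriangleClub s 1 G k).
  exists t, st; split=> //; apply: leq_trans le_t _; apply: leq_trans (Hcost n) _.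
  by rewrite leq_mul2l; case: (d) => [|d']; rewrite ?expn0 ?leq_exp2r ?leq_bit_size ?orbT.
apply: runs_seq; apply: runs_weaken (runs_init _ G k) _ => st1 fr1 c1.
apply: runs_seq; apply: runs_weaken (runs_triangles _ c1) _ => st2 fr2 c2.
have st2A : regs st2 rAns = 0 by rewrite (frame_reg fr2) // (frame_reg fr1).
have st2t : tape st2 = [::] by rewrite (frame_tape fr2) // (frame_tape fr1).
apply: runs_seq.
apply: (runs_for_balls (s := s) (B := False) (P := fun v => k <= #|ball G v i|)
  _ c2) => //.
- by rewrite st2A.
- by move=> v st3 _ c3 st3t _; apply: runs_test_size c3 st3t.
move=> st3 c3 st3t st3A.
(* The first pass has visited all centers, so the answer register now decides [Large]. *)
apply: (runs_for_balls (s := s) (B := Large)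
  (P := fun v => has_club G s k (ball G v s)) _ c3) => //.
- by rewrite st3A; split=> [[]|?] //; right.
(* A zero answer refutes [Large], so balls of radius i have fewer than k vertices; the queried ball
   of radius s lies in the one of radius c i. *)
- move=> v st4 vT c4 st4t st4A; apply: runs_query => // st4A0.
  have small w : in_triangle G w -> #|ball G w i| <= k.
    move=> wT; apply/ltnW; rewrite ltnNge; apply/negP => large.
    by move: st4A; rewrite st4A0 => /(_ (ex_intro2 _ _ w wT large)).
  apply: leq_trans (card_ball_mul c small vT).
  by apply/subset_leq_card/subset_ball.
- move=> st4 _ _ ->; split=> [[[v vT large]|[v vT [S [SB kS clS]]]]|[S kS clS]].
  + have [S BS clS] := large_ball_club le_is vT.
    by exists S => //; apply: leq_trans large (subset_leq_card BS).
  + by exists S.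
  (* Since k is positive, the solution has a vertex, and this serves as the center to query. *)
  + have /card_gt0P[v vS] : 0 < #|S| by apply: leq_trans kS.
    right; exists v; first exact: club_in_triangle clS vS.
    by exists S; split=> //; apply: club_sub_ball.
Qed.

Theorem theorem1 (s : nat) :
  (s = 4 \/ s = 7 ->
     turing_kernel (VertexTriangleClub s 1) (fun k : nat => k ^ 4)) /\
  (s = 5 ->
     turing_kernel (VertexTriangleClub s 1) (fun k : nat => k ^ 5)) /\
  (s = 6 \/ 8 <= s ->
     turing_kernel (VertexTriangleClub s 1) (fun k : nat => k ^ 3)).
Proof.
have half := odd_double_half s.
split; last split; move=> Hs;
  (* With h = [s./2] the requirement is s <= c (h - 1). For c = 3 and odd s it reads 2 h + 1 <= 3 h
     - 3, that is h >= 4; for even s it reads h >= 3. *)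
  by apply: (@turing_kernel_balls s (s./2).-1); move: Hs half; case: odd; lia.
Qed.
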